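(* Let $A\in\mathbb{R}^{n\times n}$ be symmetric, $A\neq 0$, and let $b\in\mathbb{R}^n$, $b\ne0$. Let $x_k$ be the MINRES points and $r_k=b-Ax_k$. If $1\le k<\ell$, then $$Ar_k=\|r_k\|\left(\gamma_{k+1}v_{k+1}+\delta_{k+2}v_{k+2}\right)\quad(\text{where }\delta_{k+2}v_{k+2}=0\text{ if }k=\ell-1),$$ $$\psi_k^2\equiv\|Ar_k\|^2=\|r_k\|^2\left(\gamma_{k+1}^2+\delta_{k+2}^2\right)\quad(\text{where }\delta_{k+2}=0\text{ if }k=\ell-1),$$ $$\omega_k^2\equiv\|Ax_k\|^2=\omega_{k-1}^2+\tau_k^2,\qquad \omega_0\equiv0.$$
   Context: All norms are 2-norms and exact arithmetic is assumed. Lanczos process: $v_0=0$, $\beta_1v_1=b$, and for $k=1,2,\dots$: $\alpha_k=v_k^TAv_k$, $\beta_{k+1}v_{k+1}=Av_k-\alpha_kv_k-\beta_kv_{k-1}$, where $\beta_k>0$ is chosen so that $\|v_k\|=1$. The process stops at the first index $k=\ell\le n$ for which $Av_\ell-\alpha_\ell v_\ell-\beta_\ell v_{\ell-1}=0$, and then $\beta_{\ell+1}=0$. Put $V_k=[v_1\ \cdots\ v_k]$ (orthonormal columns). $T_k$ is the symmetric tridiagonal $k\times k$ matrix with diagonal $\alpha_1,\dots,\alpha_k$ and off-diagonal $\beta_2,\dots,\beta_k$. For $k<\ell$, $\underline{T_k}=\begin{bmatrix}T_k\\ \beta_{k+1}e_k^T\end{bmatrix}\in\mathbb{R}^{(k+1)\times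 k}$, which has full column rank, and $AV_k=V_{k+1}\underline{T_k}$. MINRES points: $x_0=0$, and for $1\le k<\ell$, $x_k=V_ky_k$, where $y_k$ is the unique minimizer of $\|\underline{T_k}y-\beta_1e_1\|$ over $y\in\mathbb{R}^k$. Scalars from the QR factorization of $\underline{T_k}$ by $2\times 2$ reflectors: start with $\gamma_1=\alpha_1$, $\delta_2=\beta_2$, $\phi_0=\beta_1$. For $1\le k<\ell$ define $\gamma_k^{(2)}=\sqrt{\gamma_k^2+\beta_{k+1}^2}$, $c_k=\gamma_k/\gamma_k^{(2)}$, $s_k=\beta_{k+1}/\gamma_k^{(2)}$, and $$\begin{bmatrix}c_k & s_k \\ s_k & -c_k\end{bmatrix}\left[\begin{array}{ccc|c}\gamma_k&\delta_{k+1}&0&\phi_{k-1}\\ \beta_{k+1}&\alpha_{k+1}&\beta_{k+2}&0\end{array}\right]=\left[\begin{array}{ccc|c}\gamma_k^{(2)}&\delta_{k+1}^{(2)}&\epsilon_{k+2}&\tau_k \\ 0&\gamma_{k+1}&\delta_{k+2}&\phi_k\end{array}\right].$$ In particular $\gamma_{k+1}=s_k\delta_{k+1}-c_k\alpha_{k+1}$, $\delta_{k+2}=-c_k\beta_{k+2}$, $\tau_k=c_k\phi_{k-1}$, $\phi_k=s_k\phi_{k-1}$. *)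

(* Defs.v *)
From mathcomp Require Import all_boot all_order all_algebra.

Set Implicit Arguments.
Unset Strict Implicit.
Unset Printing Implicit Defensive.

Import Order.TTheory GRing.Theory Num.Theory.
Local Open Scope ring_scope.

Definition norm2 (R : rcfType) (n : nat) (u : 'cV[R]_n) : R :=
  Num.sqrt (\sum_i u i 0 ^+ 2).

Definition alpha_at (R : rcfType) (n : nat) (A : 'M[R]_n) (u : 'cV[R]_n) : R :=
  (u^T *m A *m u) 0 0.

Definition lanczos_step (R : rcfType) (n : nat) (A : 'M[R]_n)
    (u v : 'cV[R]_n) (be : R) : 'cV[R]_n :=
  A *m v - alpha_at A v *: v - be *: u.

(* The triple (v_k, v_(k+1), beta_(k+1)).  As 0^-1 = 0, the state reached at
   the stopping index l has beta_(l+1) = 0 and v_(l+1) = 0. *)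
Fixpoint lanczos_state (R : rcfType) (n : nat) (A : 'M[R]_n) (b : 'cV[R]_n)
    (k : nat) : 'cV[R]_n * 'cV[R]_n * R :=
  if k is j.+1 then
    let: (u, v, be) := lanczos_state A b j in
    let w := lanczos_step A u v be in
    (v, (norm2 w)^-1 *: w, norm2 w)
  else (0, (norm2 b)^-1 *: b, norm2 b).

Definition lv (R : rcfType) (n : nat) (A : 'M[R]_n) (b : 'cV[R]_n) (k : nat) :
  'cV[R]_n := (lanczos_state A b k).1.1.

(* beta_0 is not part of the process; it is given the dummy value 0. *)
Definition lbeta (R : rcfType) (n : nat) (A : 'M[R]_n) (b : 'cV[R]_n)
    (k : nat) : R :=
  if k is j.+1 then (lanczos_state A b j).2 else 0.

Definition lalpha (R : rcfType) (n : nat) (A : 'M[R]_n) (b : 'cV[R]_n)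
    (k : nat) : R := alpha_at A (lv A b k).

Definition lanczos_rhs (R : rcfType) (n : nat) (A : 'M[R]_n) (b : 'cV[R]_n)
    (k : nat) : 'cV[R]_n :=
  A *m lv A b k - lalpha A b k *: lv A b k - lbeta A b k *: lv A b k.-1.

(* The bound ell <= n is a consequence and is not imposed. *)
Definition lanczos_stop (R : rcfType) (n : nat) (A : 'M[R]_n) (b : 'cV[R]_n)
    (ell : nat) : Prop :=
  [/\ (1 <= ell)%N,
      lanczos_rhs A b ell = 0
    & forall j : nat, (1 <= j < ell)%N -> lanczos_rhs A b j <> 0].

(* Ordinals start at 0: column j of V_k is v_(j+1), and likewise in T_k. *)
Definition Vmx (R : rcfType) (n : nat) (A : 'M[R]_n) (b : 'cV[R]_n)
    (k : nat) : 'M[R]_(n, k) :=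
  \matrix_(i < n, j < k) lv A b j.+1 i 0.

Definition Tmx (R : rcfType) (n : nat) (A : 'M[R]_n) (b : 'cV[R]_n)
    (k : nat) : 'M[R]_k :=
  \matrix_(i < k, j < k)
    if i == j :> nat then lalpha A b i.+1
    else if i == j.+1 :> nat then lbeta A b i.+1
    else if j == i.+1 :> nat then lbeta A b j.+1
    else 0.

Definition Tunder (R : rcfType) (n : nat) (A : 'M[R]_n) (b : 'cV[R]_n)
    (k : nat) : 'M[R]_(k + 1, k) :=
  col_mx (Tmx A b k)
         (lbeta A b k.+1 *: \row_(j < k) (j.+1 == k :> nat)%:R).

Definition e1 (R : rcfType) (m : nat) : 'cV[R]_m :=
  \col_(i < m) (i == 0 :> nat)%:R.

Definition minres_min (R : rcfType) (n : nat) (A : 'M[R]_n) (b : 'cV[R]_n)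
    (k : nat) (y : 'cV[R]_k) : Prop :=
  forall z : 'cV[R]_k,
    norm2 (Tunder A b k *m y - lbeta A b 1 *: e1 R (k + 1))
    <= norm2 (Tunder A b k *m z - lbeta A b 1 *: e1 R (k + 1)).

Definition minres_points (R : rcfType) (n : nat) (A : 'M[R]_n) (b : 'cV[R]_n)
    (ell : nat) (x : nat -> 'cV[R]_n) : Prop :=
  x 0%N = 0 /\
  forall k : nat, (1 <= k < ell)%N ->
    exists y : 'cV[R]_k, minres_min A b y /\ x k = Vmx A b k *m y.

(* The triple (gamma_(k+1), delta_(k+2), phi_k). *)
Fixpoint qr_state (R : rcfType) (n : nat) (A : 'M[R]_n) (b : 'cV[R]_n)
    (k : nat) : R * R * R :=
  if k is j.+1 then
    let: (g, d, p) := qr_state A b j in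
    let g2 := Num.sqrt (g ^+ 2 + lbeta A b k.+1 ^+ 2) in
    let c := g / g2 in
    let s := lbeta A b k.+1 / g2 in
    (s * d - c * lalpha A b k.+1, - (c * lbeta A b k.+2), s * p)
  else (lalpha A b 1, lbeta A b 2, lbeta A b 1).

(* Meaningful for 1 <= k (gamma, c, s, tau), 2 <= k (delta), 0 <= k (phi). *)
Definition qr_gamma (R : rcfType) (n : nat) (A : 'M[R]_n) (b : 'cV[R]_n)
    (k : nat) : R := (qr_state A b k.-1).1.1.

Definition qr_delta (R : rcfType) (n : nat) (A : 'M[R]_n) (b : 'cV[R]_n)
    (k : nat) : R := (qr_state A b k.-2).1.2.

Definition qr_phi (R : rcfType) (n : nat) (A : 'M[R]_n) (b : 'cV[R]_n)
    (k : nat) : R := (qr_state A b k).2.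

Definition qr_gamma2 (R : rcfType) (n : nat) (A : 'M[R]_n) (b : 'cV[R]_n)
    (k : nat) : R :=
  Num.sqrt (qr_gamma A b k ^+ 2 + lbeta A b k.+1 ^+ 2).

Definition qr_c (R : rcfType) (n : nat) (A : 'M[R]_n) (b : 'cV[R]_n)
    (k : nat) : R := qr_gamma A b k / qr_gamma2 A b k.

Definition qr_s (R : rcfType) (n : nat) (A : 'M[R]_n) (b : 'cV[R]_n)
    (k : nat) : R := lbeta A b k.+1 / qr_gamma2 A b k.

Definition qr_tau (R : rcfType) (n : nat) (A : 'M[R]_n) (b : 'cV[R]_n)
    (k : nat) : R := qr_c A b k * qr_phi A b k.-1.

Definition minres_res (R : rcfType) (n : nat) (A : 'M[R]_n) (b : 'cV[R]_n)
    (x : nat -> 'cV[R]_n) (k : nat) : 'cV[R]_n := b - A *m x k.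

Definition minres_psi (R : rcfType) (n : nat) (A : 'M[R]_n) (b : 'cV[R]_n)
    (x : nat -> 'cV[R]_n) (k : nat) : R := norm2 (A *m minres_res A b x k).

Definition minres_omega (R : rcfType) (n : nat) (A : 'M[R]_n)
    (x : nat -> 'cV[R]_n) (k : nat) : R := norm2 (A *m x k).

(* The state-passing definitions satisfy the defining equations of the Lanczos
   process and of the QR factorization of [Tunder]. *)
Lemma norm2_eq0 (R : rcfType) (n : nat) (u : 'cV[R]_n) :
  (norm2 u == 0) = (u == 0).
Proof.
have ge0 (i : 'I_n) : true -> 0 <= u i 0 ^+ 2 by rewrite sqr_ge0.
rewrite /norm2 sqrtr_eq0; apply/idP/eqP => [le0|->].
  apply/colP => i; rewrite mxE.
  have /eqP : \sum_i u i 0 ^+ 2 == 0 by rewrite eq_le le0 sumr_ge0.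
  by move/(psumr_eq0P ge0)/(_ i isT)/eqP; rewrite sqrf_eq0 => /eqP.
by rewrite big1 // => i _; rewrite mxE expr0n.
Qed.

Lemma norm2Z (R : rcfType) (n : nat) (a : R) (u : 'cV[R]_n) :
  norm2 (a *: u) = `|a| * norm2 u.
Proof.
rewrite /norm2 -sqrtr_sqr -sqrtrM ?sqr_ge0 // mulr_sumr.
by congr Num.sqrt; apply: eq_bigr => i _; rewrite mxE exprMn.
Qed.

Lemma norm2_normalize (R : rcfType) (n : nat) (u : 'cV[R]_n) :
  u != 0 -> norm2 ((norm2 u)^-1 *: u) = 1.
Proof.
move=> u0; rewrite norm2Z ger0_norm ?invr_ge0 ?sqrtr_ge0 //.
by rewrite mulVf // norm2_eq0.
Qed.

Lemma scale_normalize (R : rcfType) (n : nat) (u : 'cV[R]_n) :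
  norm2 u *: ((norm2 u)^-1 *: u) = u.
Proof.
have [->|u0] := eqVneq u 0; first by rewrite !scaler0.
by rewrite scalerA mulfV ?scale1r // norm2_eq0.
Qed.

Lemma lanczos_stateE (R : rcfType) (n : nat) (A : 'M[R]_n) (b : 'cV[R]_n)
    (k : nat) :
  lanczos_state A b k = (lv A b k, lv A b k.+1, lbeta A b k.+1).
Proof.
by rewrite /lv /lbeta /=; case: (lanczos_state A b k) => [[u v] be].
Qed.

Lemma lanczos_stateS (R : rcfType) (n : nat) (A : 'M[R]_n) (b : 'cV[R]_n)
    (k : nat) :
  lbeta A b k.+2 = norm2 (lanczos_rhs A b k.+1) /\
  lv A b k.+2 = (norm2 (lanczos_rhs A b k.+1))^-1 *: lanczos_rhs A b k.+1.
Proof.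
have : lanczos_state A b k.+1 =
    (lv A b k.+1, (norm2 (lanczos_rhs A b k.+1))^-1 *: lanczos_rhs A b k.+1,
     norm2 (lanczos_rhs A b k.+1)) by rewrite [LHS]/= lanczos_stateE.
rewrite lanczos_stateE => E.
by split; [exact: (congr1 snd E) | exact: (congr1 (fun t => t.1.2) E)].
Qed.

Lemma lanczos_start (R : rcfType) (n : nat) (A : 'M[R]_n) (b : 'cV[R]_n) :
  lv A b 0 = 0 /\ lbeta A b 1 *: lv A b 1 = b.
Proof. by split; [|rewrite /lv /lbeta /= scale_normalize]. Qed.

Lemma lanczos_rec (R : rcfType) (n : nat) (A : 'M[R]_n) (b : 'cV[R]_n)
    (k : nat) : (1 <= k)%N ->
  lbeta A b k.+1 *: lv A b k.+1 =
  A *m lv A b k - lalpha A b k *: lv A b k - lbeta A b k *: lv A b k.-1.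
Proof.
by case: k => // k _; have [-> ->] := lanczos_stateS A b k;
  rewrite scale_normalize.
Qed.

Lemma lanczos_norm (R : rcfType) (n : nat) (A : 'M[R]_n) (b : 'cV[R]_n)
    (ell k : nat) : b != 0 -> lanczos_stop A b ell -> (1 <= k <= ell)%N ->
  0 < lbeta A b k /\ norm2 (lv A b k) = 1.
Proof.
move=> b0 [_ _ nz]; case: k => [//|[_|k /andP[_ lt]]].
  rewrite /lv /lbeta /= norm2_normalize //.
  by rewrite lt_neqAle eq_sym norm2_eq0 b0 sqrtr_ge0.
have /eqP w0 : lanczos_rhs A b k.+1 <> 0 by apply: nz.
have [-> ->] := lanczos_stateS A b k; rewrite norm2_normalize //.
by rewrite lt_neqAle eq_sym norm2_eq0 w0 sqrtr_ge0.
Qed.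

Lemma lanczos_end (R : rcfType) (n : nat) (A : 'M[R]_n) (b : 'cV[R]_n)
    (ell : nat) : lanczos_stop A b ell -> lbeta A b ell.+1 = 0.
Proof.
case: ell => [[]//|ell [_ w0 _]]; have [-> _] := lanczos_stateS A b ell.
by apply/eqP; rewrite w0 norm2_eq0.
Qed.

Lemma qr_start (R : rcfType) (n : nat) (A : 'M[R]_n) (b : 'cV[R]_n) :
  [/\ qr_gamma A b 1 = lalpha A b 1, qr_delta A b 2 = lbeta A b 2
    & qr_phi A b 0 = lbeta A b 1].
Proof. by []. Qed.

Lemma qr_rec (R : rcfType) (n : nat) (A : 'M[R]_n) (b : 'cV[R]_n) (k : nat) :
  (1 <= k)%N ->
  [/\ qr_gamma2 A b k =
        qr_c A b k * qr_gamma A b k + qr_s A b k * lbeta A b k.+1,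
      0 = qr_s A b k * qr_gamma A b k - qr_c A b k * lbeta A b k.+1
    & [/\ qr_gamma A b k.+1 =
            qr_s A b k * qr_delta A b k.+1 - qr_c A b k * lalpha A b k.+1,
          qr_delta A b k.+2 = - (qr_c A b k * lbeta A b k.+2)
        & qr_phi A b k = qr_s A b k * qr_phi A b k.-1]].
Proof.
case: k => // k _; split.
- rewrite /qr_c /qr_s mulrAC [X in _ + X]mulrAC -!expr2 -mulrDl.
  have g2 : qr_gamma2 A b k.+1 ^+ 2 =
      qr_gamma A b k.+1 ^+ 2 + lbeta A b k.+2 ^+ 2.
    by rewrite sqr_sqrtr // addr_ge0 ?sqr_ge0.
  rewrite -g2 expr2; have [->|nz] := eqVneq (qr_gamma2 A b k.+1) 0.
    by rewrite !mul0r.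
  by rewrite mulfK.
- by rewrite /qr_c /qr_s mulrAC [X in _ - X]mulrAC
    [X in X / _ - _]mulrC subrr.
- rewrite /qr_c /qr_s /qr_gamma2 /qr_gamma /qr_delta /qr_phi.
  by rewrite [qr_state A b k.+1]/=; case: (qr_state A b k) => [[g d] p].
Qed.

(* Main.v *)
(** Let [p_k] be the image under [V_(k+1)] of the last row of the product of the
    first [k] reflectors, so that [p_0 = v_1] and
    [p_k = s_k p_(k-1) - c_k v_(k+1)].  The three-term recurrence gives
    [A p_k = gamma_(k+1) v_(k+1) + delta_(k+2) v_(k+2)]; as [A] is symmetric,
    [p_k] is orthogonal to [A V_k].  Since [b - phi_k p_k] lies in the range of
    [A V_k], the residual is [r_k = phi_k p_k].  With [|p_k| = 1] this gives the
    first two identities, and [|A x_k|^2 = beta_1^2 - phi_k^2] gives the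
    third. *)
Require Import Defs.
From mathcomp Require Import all_boot all_order all_algebra.
From mathcomp Require Import zify ring.
Import Order.TTheory GRing.Theory Num.Theory.
Local Open Scope ring_scope.

Set Implicit Arguments.
Unset Strict Implicit.
Unset Printing Implicit Defensive.

(** * Inner products and the 2-norm *)

Definition dotv (R : rcfType) (n : nat) (u v : 'cV[R]_n) : R :=
  (u^T *m v) 0 0.

Lemma dotvC (R : rcfType) (n : nat) (u v : 'cV[R]_n) : dotv u v = dotv v u.
Proof. by rewrite /dotv -[u^T *m v]trmxK trmx_mul trmxK mxE. Qed.

Lemma dotvDr (R : rcfType) (n : nat) (u v w : 'cV[R]_n) :
  dotv u (v + w) = dotv u v + dotv u w.
Proof. by rewrite /dotv mulmxDr mxE. Qed.

Lemma dotvNr (R : rcfType) (n : nat) (u v : 'cV[R]_n) :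
  dotv u (- v) = - dotv u v.
Proof. by rewrite /dotv mulmxN mxE. Qed.

Lemma dotvZr (R : rcfType) (n : nat) (a : R) (u v : 'cV[R]_n) :
  dotv u (a *: v) = a * dotv u v.
Proof. by rewrite /dotv -scalemxAr mxE. Qed.

Lemma dotv0r (R : rcfType) (n : nat) (u : 'cV[R]_n) : dotv u 0 = 0.
Proof. by rewrite /dotv mulmx0 mxE. Qed.

Lemma dotvDl (R : rcfType) (n : nat) (u v w : 'cV[R]_n) :
  dotv (v + w) u = dotv v u + dotv w u.
Proof. by rewrite dotvC dotvDr !(dotvC u). Qed.

Lemma dotvNl (R : rcfType) (n : nat) (u v : 'cV[R]_n) :
  dotv (- v) u = - dotv v u.
Proof. by rewrite dotvC dotvNr dotvC. Qed.

Lemma dotvZl (R : rcfType) (n : nat) (a : R) (u v : 'cV[R]_n) :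
  dotv (a *: v) u = a * dotv v u.
Proof. by rewrite dotvC dotvZr dotvC. Qed.

Definition dotvE := (dotvDl, dotvDr, dotvNl, dotvNr, dotvZl, dotvZr).

Lemma dotv_mulmxl (R : rcfType) (m n : nat) (M : 'M[R]_(m, n))
    (u : 'cV[R]_n) (v : 'cV[R]_m) : dotv (M *m u) v = dotv u (M^T *m v).
Proof. by rewrite /dotv trmx_mul mulmxA. Qed.

Lemma norm2_sqr (R : rcfType) (n : nat) (u : 'cV[R]_n) :
  norm2 u ^+ 2 = dotv u u.
Proof.
rewrite sqr_sqrtr; last by rewrite sumr_ge0 // => i _; rewrite sqr_ge0.
by rewrite /dotv mxE; apply: eq_bigr => i _; rewrite mxE expr2.
Qed.

Lemma norm2_isometry (R : rcfType) (m n : nat) (V : 'M[R]_(m, n))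
    (u : 'cV[R]_n) : V^T *m V = 1%:M -> norm2 (V *m u) = norm2 u.
Proof.
move=> VV; apply/eqP; rewrite -(@eqrXn2 _ 2) ?sqrtr_ge0 // !norm2_sqr.
by rewrite dotv_mulmxl mulmxA VV mul1mx.
Qed.

(** * The Lanczos recurrence in matrix form *)

Section LanczosProcess.
Context (R : rcfType) (n : nat) (A : 'M[R]_n) (b : 'cV[R]_n).

Local Notation v := (lv A b).
Local Notation alpha := (lalpha A b).
Local Notation beta := (lbeta A b).
Local Notation gamma := (qr_gamma A b).
Local Notation delta := (qr_delta A b).
Local Notation phi := (qr_phi A b).
Local Notation c := (qr_c A b).
Local Notation s := (qr_s A b).

Lemma lanczos_mulmx k : (1 <= k)%N ->
  A *m v k = beta k *: v k.-1 + alpha k *: v k + beta k.+1 *: v k.+1.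
Proof.
by move=> k1; rewrite lanczos_rec // -[in RHS](addrA (A *m _)) -opprD
  [beta k *: _ + _]addrC [RHS]addrC subrK.
Qed.

Lemma lbeta_eq0 k : (beta k.+2 == 0) = (lanczos_rhs A b k.+1 == 0).
Proof. by have [-> _] := lanczos_stateS A b k; rewrite norm2_eq0. Qed.

(** By the convention [0^-1 = 0], normalizing a zero vector gives zero. This lets orthogonality
    extend to the index [ell + 1]. *)
Lemma lv_eq0 k : beta k.+2 = 0 -> v k.+2 = 0.
Proof.
move=> /eqP; rewrite lbeta_eq0 => /eqP rhs0.
by have [_ ->] := lanczos_stateS A b k; rewrite rhs0 scaler0.
Qed.

(** Written with indicators, the sum over a column splits into three sums that [sum_delta]
    evaluates. *)
Lemma Tunder_entry k (i : 'I_(k + 1)) (j : 'I_k) :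
  Tunder A b k i j =
    (i == j :> nat)%:R * alpha j.+1 + (i == j.+1 :> nat)%:R * beta j.+2
    + (i.+1 == j :> nat)%:R * beta j.+1.
Proof.
rewrite /Tunder mxE; case: splitP => i' ei; rewrite !mxE ei.
  case: (ltngtP i' j) => ij; rewrite ?(gtn_eqF ij) ?(ltn_eqF ij).
  - have -> : (i' == j.+1 :> nat) = false by apply/eqP; lia.
    by rewrite [(j : nat) == _]eq_sym; case: eqP => _ /=; ring.
  - have -> : (i'.+1 == j :> nat) = false by apply/eqP; lia.
    have -> : (j == i'.+1 :> nat) = false by apply/eqP; lia.
    by case: eqP => [->|_] /=; ring.
  - have -> : (i' == j.+1 :> nat) = false by apply/eqP; lia.
    have -> : (i'.+1 == j :> nat) = false by apply/eqP; lia.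
    by rewrite ij /=; ring.
have -> : i' = 0%N :> nat by case: i' {ei} => [[]].
have jk := ltn_ord j; rewrite addn0.
have -> : (k == j :> nat) = false by apply/eqP; lia.
have -> : (k.+1 == j :> nat) = false by apply/eqP; lia.
by rewrite [k == _]eq_sym; case: eqP => [->|_] /=; ring.
Qed.

Lemma Vmx_mul k (z : 'cV[R]_k) : Vmx A b k *m z = \sum_j z j 0 *: v j.+1.
Proof.
apply/colP => i; rewrite mxE summxE; apply: eq_bigr => j _.
by rewrite !mxE mulrC.
Qed.

Lemma sum_delta (V : lmodType R) (m : nat) (f : nat -> V) (j : nat) :
  (j < m)%N -> \sum_(i < m) (i == j :> nat)%:R *: f i = f j.
Proof.
move=> jm; rewrite (bigD1 (Ordinal jm)) //= eqxx scale1r big1 ?addr0 // => i.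
by rewrite -val_eqE /= => /negPf ->; rewrite scale0r.
Qed.

Lemma mulmx_Vmx k : A *m Vmx A b k = Vmx A b (k + 1) *m Tunder A b k.
Proof.
apply/matrixP => r j.
have -> : (A *m Vmx A b k) r j = (A *m v j.+1) r 0.
  by rewrite !mxE; apply: eq_bigr => l _; rewrite !mxE.
have -> : (Vmx A b (k + 1) *m Tunder A b k) r j =
    (\sum_i Tunder A b k i j *: v i.+1) r 0.
  rewrite mxE summxE; apply: eq_bigr => l _.
  by rewrite [in RHS]mxE [Vmx _ _ _ _ _]mxE mulrC.
congr (fun_of_matrix _ r 0); rewrite lanczos_mulmx //.
under eq_bigr => i _ do
  rewrite Tunder_entry !scalerDl !(mulrC _%:R) -!scalerA.
rewrite !big_split /= -!scaler_sumr.
have jk := ltn_ord j.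
rewrite !(sum_delta (fun i => v i.+1)); [|lia|lia].
rewrite [RHS]addrC [RHS]addrA; congr (_ *: _ + _ + _).
(* The first column has no superdiagonal entry, in agreement with [v_0 = 0]. *)
case: (j : nat) jk => [|i] ik.
  by rewrite big1 => [|i _]; rewrite ?(lanczos_start A b).1 // scale0r.
under eq_bigr => i' _ do rewrite eqSS.
by rewrite (sum_delta (fun i => v i.+1)); last lia.
Qed.

Lemma Vmx_e1 k : Vmx A b (k + 1) *m (beta 1 *: e1 R (k + 1)) = b.
Proof.
rewrite -scalemxAr Vmx_mul; under eq_bigr => i _ do rewrite mxE.
by rewrite (sum_delta (fun i => v i.+1)) ?addn1 // (lanczos_start A b).2.
Qed.

(** * The direction [p_k] of the residual *)

Fixpoint res_dir (k : nat) : 'cV[R]_n :=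
  if k is j.+1 then s k *: res_dir j - c k *: v k.+1 else v 1.

Lemma res_dirS k : res_dir k.+1 = s k.+1 *: res_dir k - c k.+1 *: v k.+2.
Proof. by []. Qed.

Lemma mulmx_res_dir k :
  A *m res_dir k = gamma k.+1 *: v k.+1 + delta k.+2 *: v k.+2.
Proof.
elim: k => [|k IH].
  rewrite lanczos_mulmx // (lanczos_start A b).1 scaler0 add0r.
  by have [-> -> _] := qr_start A b.
rewrite [res_dir _]/= mulmxBr -!scalemxAr IH lanczos_mulmx //=.
have [_ e0 [-> -> _]] := qr_rec A b (ltn0Sn k).
apply/colP => i; rewrite !mxE.
(* The coefficient of [v_(k+1)] is the entry annihilated by the reflector, so it may be added to the
   right-hand side. *)
rewrite -[RHS]addr0 -(mul0r (v k.+1 i 0)) e0; ring.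
Qed.

(** Transposed because [<=] on matrices compares row spaces. *)
Definition in_range k (u : 'cV[R]_n) := (u^T <= (A *m Vmx A b k)^T)%MS.

(** * Orthonormality of the Lanczos vectors *)

Section Orthogonality.
Context (ell : nat) (A_sym : A^T = A) (b_neq0 : b != 0)
  (stop : lanczos_stop A b ell).

Lemma dotv_sym u w : dotv (A *m u) w = dotv u (A *m w).
Proof. by rewrite dotv_mulmxl A_sym. Qed.

Lemma lv_unit k : (1 <= k <= ell)%N -> dotv (v k) (v k) = 1.
Proof.
by move=> hk; rewrite -norm2_sqr (lanczos_norm b_neq0 stop hk).2 expr1n.
Qed.

Lemma lbeta_gt0 k : (1 <= k <= ell)%N -> 0 < beta k.
Proof. by move=> hk; case: (lanczos_norm b_neq0 stop hk). Qed.

(** Strong induction on the larger index. The vanishing vectors at indices 0 and [ell + 1] are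
    included, so the recurrence needs no boundary cases. *)
Lemma lv_orthogonal i j : (i < j <= ell.+1)%N -> dotv (v i) (v j) = 0.
Proof.
elim: j {-2}j (leqnn j) i => [|m IH] j; first by case: j.
rewrite leq_eqVlt => /orP[/eqP-> {j} i|]; last by rewrite ltnS => /IH.
rewrite ltnS => /andP[im ml].
case: i im => [|i] im; first by rewrite (lanczos_start A b).1 dotvC dotv0r.
have v0 : v 0 = 0 := (lanczos_start A b).1.
case: m IH im ml => [|m] // IH im ml.
have [/lv_eq0->|be0] := eqVneq (beta m.+2) 0; first by rewrite dotv0r.
apply: (mulfI be0); rewrite mulr0 -dotvZr lanczos_rec // succnK !dotvE.
(* For neighbouring indices the term [alpha] cancels the Rayleigh quotient. *)
have [ei|ni] := eqVneq i m.
  rewrite ei lv_unit; last lia.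
  have -> : dotv (v m.+1) (A *m v m.+1) = alpha m.+1.
    by rewrite /dotv /lalpha /alpha_at mulmxA.
  rewrite [dotv _ (v m)]dotvC IH; [ring|lia|lia].
have im' : (i < m)%N by lia.
(* Symmetry moves [A] to the lower vector, whose recurrence reaches [v_(m+1)] only if [i + 1 = m];
   then the two terms in [beta_(m+1)] cancel. *)
rewrite -dotv_sym lanczos_mulmx // succnK !dotvE.
rewrite (IH m.+1 _ i) ?(IH m.+1 _ i.+1) //; try lia.
have [ei|nim] := eqVneq i.+1 m.
  by rewrite -ei !lv_unit; [ring|lia|lia].
rewrite (IH m.+1 _ i.+2) ?(IH m _ i.+1) //; try lia.
ring.
Qed.

Lemma Vmx_orthonormal k : (k <= ell)%N ->
  (Vmx A b k)^T *m Vmx A b k = 1%:M.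
Proof.
move=> kl; apply/matrixP => i j.
have -> : ((Vmx A b k)^T *m Vmx A b k) i j = dotv (v i.+1) (v j.+1).
  by rewrite /dotv !mxE; apply: eq_bigr => l _; rewrite !mxE.
have [ik jk] := (ltn_ord i, ltn_ord j).
rewrite mxE -val_eqE; case: (ltngtP i j) => ij /=.
- by rewrite lv_orthogonal //; lia.
- by rewrite dotvC lv_orthogonal //; lia.
- by rewrite ij lv_unit //; lia.
Qed.

(** The isometry [V_(k+1)] turns the small least-squares problem into minimization of the residual
    over the range of [A V_k]. *)
Lemma minres_norm2 k (z : 'cV[R]_k) : (k < ell)%N ->
  norm2 (Tunder A b k *m z - beta 1 *: e1 R (k + 1)) =
  norm2 (b - A *m (Vmx A b k *m z)).
Proof.
move=> kl; rewrite -(@norm2_isometry _ _ _ (Vmx A b (k + 1))); last first.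
  by rewrite Vmx_orthonormal ?addn1.
rewrite mulmxBr Vmx_e1 !mulmxA -mulmx_Vmx.
by rewrite -opprB -[- _]scaleN1r norm2Z normrN1 mul1r.
Qed.

(** * Reflector scalars and orthogonality of [p_k] *)

Lemma qr_gamma2_gt0 k : (1 <= k < ell)%N -> 0 < qr_gamma2 A b k.
Proof.
(* Positivity comes from [beta_(k+1)] alone, as [gamma_k] may vanish. *)
move=> hk; rewrite sqrtr_gt0 ltr_wpDl ?sqr_ge0 //.
by rewrite exprn_gt0 // lbeta_gt0 //; lia.
Qed.

Lemma qr_cs_unit k : (1 <= k < ell)%N -> c k ^+ 2 + s k ^+ 2 = 1.
Proof.
move=> hk; have g2 := qr_gamma2_gt0 hk.
rewrite /qr_c /qr_s !expr_div_n -mulrDl -[X in X / _]sqr_sqrtr.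
  by rewrite divff // expf_neq0 // gt_eqF.
by rewrite addr_ge0 ?sqr_ge0.
Qed.

(** Fixes the sign, so that the residual norm is [phi_k] itself. *)
Lemma qr_phi_ge0 k : (k < ell)%N -> 0 <= phi k.
Proof.
elim: k => [|k IH] kl; first by rewrite ltW // lbeta_gt0 //; lia.
have [_ _ [_ _ ->]] := qr_rec A b (ltn0Sn k).
rewrite mulr_ge0 ?IH //; last by lia.
by rewrite divr_ge0 ?sqrtr_ge0 // ltW // lbeta_gt0.
Qed.

(** [p_k] is a combination of [v_1], ..., [v_(k+1)]. *)
Lemma res_dir_orthogonal k j : (k.+1 < j <= ell.+1)%N ->
  dotv (res_dir k) (v j) = 0.
Proof.
elim: k => [|k IH] hj; first by rewrite lv_orthogonal.
by rewrite !dotvE IH ?lv_orthogonal; [ring|lia|lia].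
Qed.

Lemma res_dir_unit k : (k < ell)%N -> dotv (res_dir k) (res_dir k) = 1.
Proof.
elim: k => [|k IH] kl; first by rewrite lv_unit.
rewrite /= !dotvE [dotv (v _) (res_dir k)]dotvC res_dir_orthogonal; last lia.
rewrite IH ?lv_unit; [|lia|lia].
by rewrite -[RHS](@qr_cs_unit k.+1) //; ring.
Qed.

Lemma res_dir_orthogonal_range k (z : 'cV[R]_k) : (k < ell)%N ->
  dotv (res_dir k) (A *m (Vmx A b k *m z)) = 0.
Proof.
move=> kl; rewrite -dotv_sym mulmx_res_dir Vmx_mul.
rewrite /dotv mulmx_sumr summxE big1 // => j _; rewrite -/(dotv _ _).
have jk := ltn_ord j.
rewrite !dotvE ![dotv _ (v j.+1)]dotvC !lv_orthogonal; [ring|lia|lia].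
Qed.

(** * Vectors in the range of [A V_k] *)

Lemma in_rangeP k u :
  reflect (exists z : 'cV[R]_k, u = A *m (Vmx A b k *m z)) (in_range k u).
Proof.
apply: (iffP submxP) => [[z uz]|[z ->]].
  by exists z^T; rewrite mulmxA -[u]trmxK uz trmx_mul trmxK.
by exists z^T; rewrite -trmx_mul mulmxA.
Qed.

Lemma in_rangeD k u w : in_range k u -> in_range k w -> in_range k (u + w).
Proof. by rewrite /in_range linearD; apply: addmx_sub. Qed.

Lemma in_rangeZ k a u : in_range k u -> in_range k (a *: u).
Proof. by rewrite /in_range linearZ; apply: scalemx_sub. Qed.

Lemma in_range_lv k j : (j < k)%N -> in_range k (A *m v j.+1).
Proof.
move=> jk; rewrite /in_range trmx_mul trmx_mul submxMr //.
have -> : (v j.+1)^T = row (Ordinal jk) (Vmx A b k)^T.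
  by apply/rowP => i; rewrite !mxE.
exact: row_sub.
Qed.

Lemma in_range_trans k m u : (k <= m)%N -> in_range k u -> in_range m u.
Proof.
move=> km /in_rangeP[z ->]; rewrite Vmx_mul mulmx_sumr.
elim/big_ind: _ => [|? ?|j _]; first by rewrite /in_range trmx0 sub0mx.
  exact: in_rangeD.
rewrite -scalemxAr; apply/in_rangeZ/in_range_lv.
exact: leq_trans (ltn_ord j) km.
Qed.

(* The component of [A v_(k+1)] orthogonal to [A V_k], divided by
   [gamma_(k+1)^(2)]. *)
Definition range_dir k : 'cV[R]_n := c k.+1 *: res_dir k + s k.+1 *: v k.+2.

Lemma range_dir_gamma2 k : (k.+1 < ell)%N ->
  qr_gamma2 A b k.+1 *: range_dir k =
  gamma k.+1 *: res_dir k + beta k.+2 *: v k.+2.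
Proof.
move=> kl; have g2 : qr_gamma2 A b k.+1 != 0 by rewrite gt_eqF ?qr_gamma2_gt0.
by rewrite scalerDr !scalerA /qr_c /qr_s !(mulrC (qr_gamma2 A b k.+1)) !divfK.
Qed.

(** The reflector maps the pair [p_k], [v_(k+2)] to [range_dir k], [p_(k+1)]. The coefficient left
    on [range_dir k] is [epsilon_(k+3)]. *)
Lemma lv_range_dir k : (k.+1 < ell)%N ->
  beta k.+3 *: v k.+2 - delta k.+3 *: res_dir k.+1 =
  (beta k.+3 * s k.+1) *: range_dir k.
Proof.
rewrite /range_dir => kl; have cs : s k.+1 ^+ 2 = 1 - c k.+1 ^+ 2.
  by rewrite -(@qr_cs_unit k.+1) // addrAC subrr add0r.
have [_ _ [_ -> _]] := qr_rec A b (ltn0Sn k).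
rewrite res_dirS; move: (res_dir k) => p.
apply/colP => i; rewrite !mxE; ring: cs.
Qed.

(** Same change of basis; the remaining coefficient is the entry [delta_(k+2)^(2)] of the triangular
    factor. *)
Lemma range_dir_alpha k : (k.+1 < ell)%N ->
  delta k.+2 *: res_dir k + alpha k.+2 *: v k.+2 - gamma k.+2 *: res_dir k.+1 =
  (delta k.+2 * c k.+1 + alpha k.+2 * s k.+1) *: range_dir k.
Proof.
rewrite /range_dir => kl; have cs : s k.+1 ^+ 2 = 1 - c k.+1 ^+ 2.
  by rewrite -(@qr_cs_unit k.+1) // addrAC subrr add0r.
have [_ _ [-> _ _]] := qr_rec A b (ltn0Sn k).
rewrite res_dirS; move: (res_dir k) => p.
apply/colP => i; rewrite !mxE; ring: cs.
Qed.

Lemma range_dir_in_range k : (k.+1 < ell)%N -> in_range k.+1 (range_dir k).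
Proof.
elim/ltn_ind: k => k IH kl.
have g2 : qr_gamma2 A b k.+1 != 0 by rewrite gt_eqF ?qr_gamma2_gt0.
rewrite -[range_dir k]scale1r -(mulVf g2) -scalerA; apply: in_rangeZ.
rewrite range_dir_gamma2 //; case: k IH kl {g2} => [|k] IH kl.
  have [-> _ _] := qr_start A b.
  suff -> : alpha 1 *: res_dir 0 + beta 2 *: v 2 = A *m v 1.
    exact: in_range_lv.
  by rewrite lanczos_mulmx // (lanczos_start A b).1 scaler0 add0r.
have IH' j : (j <= k)%N -> in_range k.+2 (range_dir j).
  by move=> jk; apply: (@in_range_trans j.+1); [lia|apply: IH; lia].
(* One column of the QR factorization of [A V_(k+2)], solved for its newest direction; the two
   subtracted terms are multiples of earlier directions. *)
have -> : gamma k.+2 *: res_dir k.+1 + beta k.+3 *: v k.+3 =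
    A *m v k.+2 + (-1) *: (beta k.+2 *: v k.+1 - delta k.+2 *: res_dir k
      + (delta k.+2 * c k.+1 + alpha k.+2 * s k.+1) *: range_dir k).
  rewrite -range_dir_alpha ?(ltnW kl) // lanczos_mulmx //.
  move: (res_dir k) (res_dir k.+1) => p p'.
  by apply/colP => i; rewrite !mxE; ring.
apply: in_rangeD; first exact: in_range_lv.
apply/in_rangeZ/in_rangeD; last exact/in_rangeZ/IH'.
case: k IH kl IH' => [|k] IH kl IH'.
  (* Here [delta_2 = beta_2] and [p_0 = v_1], so the [epsilon] term is absent. *)
  by have [_ -> _] := qr_start A b; rewrite subrr /in_range trmx0 sub0mx.
by rewrite lv_range_dir; [apply/in_rangeZ/IH'|lia].
Qed.

Lemma res_dir_in_range k : (k < ell)%N -> in_range k (b - phi k *: res_dir k).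
Proof.
elim: k => [|k IH] kl.
  by rewrite /= (lanczos_start A b).2 subrr /in_range trmx0 sub0mx.
have [_ _ [_ _ ->]] := qr_rec A b (ltn0Sn k).
have cs : s k.+1 ^+ 2 = 1 - c k.+1 ^+ 2.
  by rewrite -(@qr_cs_unit k.+1) // addrAC subrr add0r.
(* The update of [A x_k] is [tau_(k+1)] times the new direction. *)
have -> : b - (s k.+1 * phi k) *: res_dir k.+1 =
    (b - phi k *: res_dir k) + (c k.+1 * phi k) *: range_dir k.
  rewrite /range_dir res_dirS; move: (res_dir k) => p.
  by apply/colP => i; rewrite !mxE; ring: cs.
apply: in_rangeD; last exact/in_rangeZ/range_dir_in_range.
by apply: (@in_range_trans k) => //; apply: IH; lia.
Qed.

(** * The residual at the minimizer *)

Lemma minres_residual k (y : 'cV[R]_k) : (k < ell)%N -> minres_min A b y ->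
  b - A *m (Vmx A b k *m y) = phi k *: res_dir k.
Proof.
move=> kl min_y; have /in_rangeP[z bz] := res_dir_in_range kl.
have orth := res_dir_orthogonal_range (z - y) kl.
set d := A *m (Vmx A b k *m (z - y)) in orth.
have ry : b - A *m (Vmx A b k *m y) = phi k *: res_dir k + d.
  by rewrite /d !mulmxBr -bz addrA addrC; apply/colP => i; rewrite !mxE; ring.
have rz : b - A *m (Vmx A b k *m z) = phi k *: res_dir k.
  by rewrite -bz opprB addrC subrK.
suff d0 : d = 0 by rewrite ry d0 addr0.
(* By Pythagoras the residual of [y] exceeds that of [z] by [|d|^2] in squared norm, so minimality
   forces [d = 0]. *)
have := min_y z; rewrite !minres_norm2 // ry rz.
rewrite -ler_sqr ?nnegrE ?sqrtr_ge0 // !norm2_sqr !dotvE.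
rewrite [dotv d (res_dir k)]dotvC orth !mulr0 addr0 add0r gerDl.
by rewrite -norm2_sqr exprn_even_le0 //= norm2_eq0 => /eqP.
Qed.

Lemma minres_omega_sqr k (y : 'cV[R]_k) : (k < ell)%N -> minres_min A b y ->
  norm2 (A *m (Vmx A b k *m y)) ^+ 2 = beta 1 ^+ 2 - phi k ^+ 2.
Proof.
move=> kl min_y; have orth := res_dir_orthogonal_range y kl.
set d := A *m _ in orth *.
have -> : beta 1 ^+ 2 = dotv (phi k *: res_dir k + d) (phi k *: res_dir k + d).
  by rewrite -(minres_residual kl min_y) subrK -norm2_sqr.
rewrite norm2_sqr !dotvE [dotv d (res_dir k)]dotvC orth (res_dir_unit kl); ring.
Qed.

End Orthogonality.
End LanczosProcess.

(** * The three MINRES identities *)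

Theorem lemma3p3 (R : rcfType) (n : nat) (A : 'M[R]_n) (b : 'cV[R]_n)
    (ell : nat) (x : nat -> 'cV[R]_n)
    (hsym : A^T = A) (hA : A != 0) (hb : b != 0)
    (hell : lanczos_stop A b ell)
    (hx : minres_points A b ell x)
    (k : nat) (hk : (1 <= k < ell)%N) :
  [/\ A *m minres_res A b x k =
        norm2 (minres_res A b x k) *:
          (qr_gamma A b k.+1 *: lv A b k.+1 + qr_delta A b k.+2 *: lv A b k.+2)
        /\ (k = ell.-1 -> qr_delta A b k.+2 *: lv A b k.+2 = 0),
      minres_psi A b x k ^+ 2 =
        norm2 (minres_res A b x k) ^+ 2 *
          (qr_gamma A b k.+1 ^+ 2 + qr_delta A b k.+2 ^+ 2)
        /\ (k = ell.-1 -> qr_delta A b k.+2 = 0)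
    & minres_omega A x k ^+ 2 =
        minres_omega A x k.-1 ^+ 2 + qr_tau A b k ^+ 2
        /\ minres_omega A x 0 = 0].
Proof.
have [x0 x_min] := hx; have kl : (k < ell)%N by lia.
have last_delta : k = ell.-1 -> qr_delta A b k.+2 = 0.
  move=> kE; have [_ _ [_ -> _]] := @qr_rec R n A b k ltac:(lia).
  have -> : k.+2 = ell.+1 by lia.
  by rewrite (lanczos_end hell) mulr0 oppr0.
have rE : minres_res A b x k = qr_phi A b k *: res_dir A b k.
  rewrite /minres_res; have [y [min_y ->]] := x_min k hk.
  exact: (minres_residual hsym hb hell kl min_y).
have norm_r : norm2 (minres_res A b x k) = qr_phi A b k.
  apply/eqP; rewrite -(@eqrXn2 _ 2) ?sqrtr_ge0 ?(qr_phi_ge0 hb hell kl) //.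
  rewrite norm2_sqr rE !dotvE (res_dir_unit hsym hb hell kl).
  by apply/eqP; ring.
have ArE : A *m minres_res A b x k = norm2 (minres_res A b x k) *:
    (qr_gamma A b k.+1 *: lv A b k.+1 + qr_delta A b k.+2 *: lv A b k.+2).
  by rewrite norm_r rE -scalemxAr mulmx_res_dir.
have omega0 : minres_omega A x 0 = 0.
  by rewrite /minres_omega x0 mulmx0; apply/eqP; rewrite norm2_eq0.
(* Includes [j = 0], where [phi_0 = beta_1], since [k - 1] may be 0. *)
have omegaE j : (j <= k)%N ->
    minres_omega A x j ^+ 2 = lbeta A b 1 ^+ 2 - qr_phi A b j ^+ 2.
  case: j => [|j] jk; first by rewrite omega0 subrr expr0n.
  rewrite /minres_omega; have [|y [min_y ->]] := x_min j.+1; first by lia.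
  by apply: (@minres_omega_sqr R n A b ell) => //; lia.
do !split=> //.
- by move=> /last_delta ->; rewrite scale0r.
- rewrite /minres_psi ArE norm2Z exprMn real_normK ?num_real //.
  congr (_ * _); rewrite norm2_sqr !dotvE.
  rewrite (lv_unit hb hell); last lia.
  rewrite [dotv (lv A b k.+2) (lv A b k.+1)]dotvC.
  rewrite (lv_orthogonal hsym hb hell); last lia.
  (* At [k = ell - 1] the vector [v_(k+2)] is not a unit vector, but its coefficient vanishes. *)
  have [/last_delta ->|kn] := eqVneq k ell.-1; first by ring.
  by rewrite (lv_unit hb hell); [ring|lia].
- rewrite !omegaE ?leq_pred //.
  have [_ _ [_ _ ->]] := @qr_rec R n A b k ltac:(lia).
  rewrite /qr_tau.
  have cs : qr_s A b k ^+ 2 = 1 - qr_c A b k ^+ 2.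
    by rewrite -(qr_cs_unit hb hell hk) addrAC subrr add0r.
  by ring: cs.
Qed.
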